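(* Let $D$ be a weighted oriented graph and let $I=I(D)$ be its edge ideal. Suppose there are weighted naturally oriented unicyclic subgraphs $D_1,\dots,D_s$ of $D$ such that $V(D_1),\dots,V(D_s)$ is a partition of $V(D)$ and, for each $i$, $w(x)\neq 1$ for every vertex $x\in V(D_i)$ with $\deg_{D_i}(x)>1$. Then $I^{(k)}=I^k$ for all $k\ge 1$.
   Context: A weighted oriented graph $D=(V(D),E(D),w)$ consists of a finite simple graph $G$ (the underlying graph) on vertices $V(D)=\{x_1,\dots,x_n\}$, an orientation of each edge of $G$ (the pair $(x_i,x_j)\in E(D)$ denotes the edge directed from $x_i$ to $x_j$), and a weight function $w:V(D)\to\mathbb{N}=\{1,2,\dots\}$. If $x$ is a source (only arrows leaving $x$), one always assumes $w(x)=1$. Let $R=K[x_1,\dots,x_n]$ with $K$ a field (vertices are identified with variables). The edge ideal of $D$ is $I(D)=(x_ix_j^{w(x_j)} : (x_i,x_j)\in E(D))\subseteq R$. The subgraphs $D_i$ carry the orientation and weights inherited from $D$. $\deg_{D_i}(x)$ is the number of neighbours of $x$ in $D_i$. A unicyclic graph is a connected graph with exactly one cycle. A cycle is naturally oriented if all its edges are oriented in the clockwise direction (so the cycle is a directed cycle). In a naturally oriented unicyclic graph, the cycle is naturally oriented and each edge of the trees attached to the cycle is oriented away from the cycle. For a homogeneous ideal $I\subset R$, the $m$-th symbolic power is $I^{(m)}=\bigcap_{p\in \mathrm{Ass}(I)}(I^mR_p\cap R)$, the intersection being over all associated primes of $I$. *)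

(* Defs.v *)
From HB Require Import structures.
From mathcomp Require Import all_boot all_order all_algebra.
From mathcomp Require Import boolp classical_sets.
From mathcomp Require Import mpoly.

Set Implicit Arguments.
Unset Strict Implicit.
Unset Printing Implicit Defensive.

Import GRing.Theory.
Local Open Scope ring_scope.

(* Ideals are represented by their underlying sets of elements. *)

(* The finite sums of products a * b with a in A and b in B.  With B = setT
   this is the ideal generated by A; for ideals A, B it is the product AB. *)
Definition sums_of_products (R : comNzRingType) (A B : set R) : set R :=
  [set f | exists l : seq (R * R),
     (forall u, u \in l -> A u.1 /\ B u.2) /\
     f = \sum_(u <- l) u.1 * u.2]%classic.

Definition ideal_span (R : comNzRingType) (S : set R) : set R :=
  sums_of_products S setT.

Definition ideal_exp (R : comNzRingType) (I : set R) (k : nat) : set R :=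
  iter k (sums_of_products I) setT.

Definition prime_ideal (R : comNzRingType) (p : set R) : Prop :=
  idealr_closed [pred f | f \in p] /\ prime_idealr_closed [pred f | f \in p].

(* Ass(I): the primes that are annihilators of elements of R / I. *)
Definition Ass (R : comNzRingType) (I : set R) : set (set R) :=
  [set p | prime_ideal p /\
     exists f : R, p = [set g | I (g * f)]%classic]%classic.

(* R_p, inside the field of fractions of the domain R. *)
Definition localization (R : idomainType) (p : set R) : set {fraction R} :=
  [set z | exists a s : R, ~ p s /\ z = tofrac a / tofrac s]%classic.

(* J R_p, the extension of the ideal J to R_p. *)
Definition localized_ideal (R : idomainType) (p J : set R) :
    set {fraction R} :=
  sums_of_products [set tofrac a | a in J]%classic (localization p).

Definition symbolic_power (R : idomainType) (I : set R) (m : nat) : set R :=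
  (\bigcap_(p in Ass I)
     [set f | localized_ideal p (ideal_exp I m) (tofrac f)])%classic.

Record wodigraph (n : nat) := WODigraph {
  arcs : {set 'I_n * 'I_n};
  weight : 'I_n -> nat;
  arcs_irrefl : forall x, (x, x) \notin arcs;
  arcs_asym : forall x y, (x, y) \in arcs -> (y, x) \notin arcs;
  weight_gt0 : forall x, (0 < weight x)%N;
  weight_source : forall x,
    (exists y, (x, y) \in arcs) -> (forall y, (y, x) \notin arcs) ->
    weight x = 1%N
}.

(* Not necessarily induced. *)
Record subdigraph (n : nat) (D : wodigraph n) := Subdigraph {
  sverts : {set 'I_n};
  sarcs : {set 'I_n * 'I_n};
  sarcs_sub : sarcs \subset arcs D;
  sarcs_verts : forall x y,
    (x, y) \in sarcs -> (x \in sverts) && (y \in sverts)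
}.

Section Subdigraph.
Variables (n : nat) (D : wodigraph n) (H : subdigraph D).

Definition sarc : rel 'I_n := fun x y => (x, y) \in sarcs H.

Definition sadj : rel 'I_n := fun x y => sarc x y || sarc y x.

Definition sdeg (x : 'I_n) : nat := #|[set y | sadj x y]%SET|.

Definition sconnected : Prop :=
  (exists x, x \in sverts H) /\
  (forall x y, x \in sverts H -> y \in sverts H -> connect sadj x y).

Definition is_cycle (c : seq 'I_n) : Prop := ucycle sadj c /\ (2 < size c)%N.

(* The edge set determines a cycle, forgetting the starting point and the
   direction of traversal of the sequence c. *)
Definition cycle_edges (c : seq 'I_n) : {set {set 'I_n}} :=
  [set [set x; next c x]%SET | x in c]%SET.

Definition unicyclic : Prop :=
  sconnected /\
  exists c, is_cycle c /\
    forall c', is_cycle c' -> cycle_edges c' = cycle_edges c.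

(* For an edge {x, y} of a tree attached to the cycle c, the end x is the one
   nearer to c exactly when x can be reached from c without visiting y. *)
Definition away_from (c : seq 'I_n) (x y : 'I_n) : Prop :=
  exists z p, [/\ z \in c, path sadj z p, last z p = x & y \notin z :: p].

(* The sequence c is required to be a directed cycle; either of the two
   directions of traversal may be called clockwise. *)
Definition naturally_oriented_unicyclic : Prop :=
  unicyclic /\
  exists c, [/\ is_cycle c, cycle sarc c &
    forall x y, sarc x y -> [set x; y]%SET \notin cycle_edges c ->
      away_from c x y].

End Subdigraph.

Definition edge_ideal (K : fieldType) (n : nat) (D : wodigraph n) :
    set {mpoly K[n]} :=
  ideal_span [set m | exists x y : 'I_n,
    (x, y) \in arcs D /\ m = 'X_x * 'X_y ^+ weight D y]%classic.

Arguments edge_ideal K {n} D _.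

(* Main.v *)
Require Import Defs.
From HB Require Import structures.
From mathcomp Require Import all_boot all_order all_algebra.
From mathcomp Require Import boolp classical_sets.
From mathcomp Require Import mpoly ring.

(* In a naturally oriented unicyclic digraph every vertex x has an in-neighbour
   y, and y, having an in-neighbour of its own, has degree at least 2; hence
   w(y) >= 2.  Therefore the monomial F, the product of the x_i^(w(x_i)-1) over
   all vertices, is not in I but all the x_i F are, so the maximal ideal m of
   the origin is associated to I.  The component of the symbolic power at m is
   I^k itself: if g f is in the monomial ideal I^k and g(0) <> 0, then f is in
   I^k. *)

(** * In-neighbours in naturally oriented unicyclic digraphs *)

Section Predecessors.
Set Implicit Arguments.
Unset Strict Implicit.

(** A step whose two ends form [A] would visit [v]. This turns the avoidance of a vertex into the
    avoidance of an edge at it. *)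
Lemma path_avoid {T : finType} (e : rel T) (A : {set T}) (v u : T) (q : seq T) :
  v \in A -> v \notin u :: q -> path e u q ->
  path [rel a b | e a b && ([set a; b]%SET != A)] u q.
Proof.
move=> vA vNq; apply: (@sub_in_path _ (mem (u :: q))); last exact/allP.
move=> a b au bu /= ->; apply: contraNneq vNq => defA.
by move: vA; rewrite -defA !inE => /orP[] /eqP->.
Qed.

Lemma in_cycle_edges {n} (c : seq 'I_n) (x y : 'I_n) :
  [set x; y]%SET \in cycle_edges c -> x \in c.
Proof.
case/imsetP=> a ac exy.
have: x \in [set x; y]%SET by rewrite !inE eqxx.
by rewrite exy !inE => /orP[] /eqP->; rewrite ?mem_next.
Qed.

Context {n : nat} {D : wodigraph n} (H : subdigraph D).

Lemma sadj_sym : ssrbool.symmetric (sadj H).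
Proof. by move=> x y; rewrite /sadj orbC. Qed.

(** A simple path from [x] to [y] that does not use the edge {x, y} is closed into a cycle by that
    edge. *)
Lemma edge_on_cycle (x y : 'I_n) :
  x != y -> sadj H y x ->
  connect [rel a b | sadj H a b && ([set a; b]%SET != [set x; y]%SET)] x y ->
  exists2 c, is_cycle H c & [set x; y]%SET \in cycle_edges c.
Proof.
move=> neq_xy adj_yx /connectP[p0 path_p0]; case: (shortenP path_p0).
case/lastP=> [|p y'] path_p uniq_p _ def_y.
  by rewrite def_y /= eqxx in neq_xy.
rewrite last_rcons in def_y; rewrite -{}def_y {y'} in path_p uniq_p *.
exists (x :: rcons p y).
  split; last first.
    (* With [p] empty the path would be the excluded edge itself, so the cycle has at least three
       vertices. *)
    case: p path_p {uniq_p} => [/andP[/andP[_]]|a p _]; first by case/eqP.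
    by rewrite /= size_rcons.
  rewrite /ucycle uniq_p /= andbT rcons_path last_rcons adj_yx andbT.
  by apply: sub_path path_p => a b /andP[].
apply/imsetP; exists y; first by rewrite inE mem_rcons mem_head orbT.
by rewrite -(next_rotr 1 uniq_p) -rcons_cons rotr1_rcons /= eqxx finset.setUC.
Qed.

(* Off the cycle c, take the last edge {y, x} of a simple path from c to x.  If
   it were directed from x to y, there would also be a path from c to x avoiding
   y, and {y, x} would lie on a second cycle. *)
Lemma natural_orientation_pred (x : 'I_n) :
  naturally_oriented_unicyclic H -> x \in sverts H -> exists y, sarc H y x.
Proof.
move=> [[[_ conn] [c0 [_ c0_unique]]] [c [cyc_c arc_c away]]] xH.
case: (boolP (x \in c)) => [xc | xNc].
  by exists (prev c x); apply: prev_cycle.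
have [z0 z0c] : exists z0, z0 \in c.
  by case: cyc_c => _; case: (c) => // z0 c' _; exists z0; apply: mem_head.
have z0H : z0 \in sverts H.
  by have /sarcs_verts/andP[] := prev_cycle arc_c z0c.
have /connectP[p0 path_p0] := conn _ _ z0H xH; case: (shortenP path_p0).
case/lastP=> [|p x'] path_p uniq_p _ def_x; first by rewrite def_x z0c in xNc.
rewrite last_rcons in def_x; rewrite -{}def_x {x'} in path_p uniq_p.
move: path_p; rewrite rcons_path; set y := last z0 p => /andP[path_p adj_yx].
move: uniq_p; rewrite -rcons_cons rcons_uniq => /andP[xNp _].
exists y; case/orP: (adj_yx) => // arc_xy; exfalso.
have neq_xy : x != y by apply: contraNneq xNp => ->; apply: mem_last.
have xyNc : [set x; y]%SET \notin cycle_edges c.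
  by apply: contra xNc; apply: in_cycle_edges.
have [z [q [zc path_q last_q yNq]]] := away _ _ arc_xy xyNc.
set e := [rel a b | sadj H a b && ([set a; b]%SET != [set x; y]%SET)].
have e_sym : connect_sym e.
  by apply: sym_connect_sym => a b; rewrite /= sadj_sym finset.setUC.
have xS : x \in [set x; y]%SET by rewrite !inE eqxx.
have yS : y \in [set x; y]%SET by rewrite !inE eqxx orbT.
have z_x : connect e z x.
  by apply/connectP; exists q => //; apply: path_avoid yS yNq path_q.
have z0_y : connect e z0 y.
  by apply/connectP; exists p => //; apply: path_avoid xS xNp path_p.
(* Both [z] and [z0] lie on [c], which misses [x]: going once around [c] from [z] reaches [z0]
   without the edge {x, y}. *)
have z_z0 : connect e z z0.
  have [i r def_r] := rot_to zc.
  have mem_r a : (a \in z :: rcons r z) = (a \in c).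
    by rewrite -(mem_rot i c) def_r !inE mem_rcons inE orbA orbb.
  have path_r : path (sadj H) z (rcons r z).
    by case: cyc_c => /andP[+ _] _; rewrite -(rot_cycle i) def_r.
  have xNr : x \notin z :: rcons r z by rewrite mem_r.
  by rewrite (path_connect (path_avoid xS xNr path_r)) ?mem_r.
have x_y : connect e x y.
  rewrite e_sym in z_x; exact: connect_trans z_x (connect_trans z_z0 z0_y).
have [c' cyc_c' xy_c'] := edge_on_cycle neq_xy adj_yx x_y.
(* The cycles [c] and [c'] both have the edge set of [c0], yet {x, y} is an edge of [c'] and not of
   [c]. *)
by move: xyNc; rewrite (c0_unique _ cyc_c) -(c0_unique _ cyc_c') xy_c'.
Qed.

(** Going back twice gives arcs z -> y -> x, and z differs from x because [arcs D] never contains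
    both an arc and its reverse; so y has two neighbours. *)
Lemma natural_orientation_pred_deg (x : 'I_n) :
  naturally_oriented_unicyclic H -> x \in sverts H ->
  exists y, [/\ sarc H y x, y \in sverts H & 1 < sdeg H y].
Proof.
move=> natH xH; have [y arc_yx] := natural_orientation_pred natH xH.
have /andP[yH _] := sarcs_verts arc_yx.
have [z arc_zy] := natural_orientation_pred natH yH.
exists y; split=> //; rewrite /sdeg.
have neq_zx : z != x.
  apply/eqP=> def_z; rewrite {}def_z in arc_zy.
  have sub := fintype.subsetP (sarcs_sub H).
  by have := arcs_asym (sub _ arc_zy); rewrite (sub _ arc_yx).
rewrite -[2]/(true.+1) -neq_zx -cards2; apply: fintype.subset_leq_card.
apply/fintype.subsetP=> a; rewrite !inE /sadj.
by case/orP=> /eqP->; rewrite ?arc_zy ?arc_yx ?orbT.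
Qed.

End Predecessors.

(** * Ideals and their extensions to localizations *)

Section Ideals.
Set Implicit Arguments.
Unset Strict Implicit.
Local Open Scope ring_scope.
Import GRing.Theory.

(** Unlike [idealr_closed], this admits the unit ideal, which is the value of [ideal_exp] at
    exponent 0. *)
Definition is_ideal {R : comNzRingType} (J : set R) : Prop :=
  J 0 /\ forall a u v, J u -> J v -> J (a * u + v).

Lemma is_idealM {R : comNzRingType} (J : set R) a u :
  is_ideal J -> J u -> J (a * u).
Proof. by case=> J0 JD Ju; rewrite -[a * u]addr0; apply: JD. Qed.

Lemma is_ideal_sum {R : comNzRingType} (J : set R) (I : eqType) (l : seq I)
    (F : I -> R) :
  is_ideal J -> (forall i, i \in l -> J (F i)) -> J (\sum_(i <- l) F i).
Proof.
move=> [J0 JD] JF; rewrite big_seq; apply: big_ind => // u v Ju Jv.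
by rewrite -[u]mul1r; apply: JD.
Qed.

Lemma sums_of_products_mul {R : comNzRingType} (A B : set R) a b :
  A a -> B b -> sums_of_products A B (a * b).
Proof.
move=> Aa Bb; exists [:: (a, b)]; rewrite big_seq1; split=> // u.
by rewrite inE => /eqP->.
Qed.

(** Multipliers are absorbed by the second factors, so [A] may be a mere generating set. *)
Lemma sums_of_products_ideal {R : comNzRingType} (A B : set R) :
  is_ideal B -> is_ideal (sums_of_products A B).
Proof.
move=> idB; split; first by exists [::]; rewrite big_nil.
move=> a _ _ [l [Hl ->]] [l' [Hl' ->]].
exists ([seq (u.1, a * u.2) | u <- l] ++ l'); split.
  move=> u; rewrite mem_cat => /orP[/mapP[v /Hl[Av Bv] ->]|/Hl' //].
  by split=> //; apply: is_idealM.
rewrite big_cat big_map mulr_sumr; congr (_ + _).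
by apply: eq_bigr => u _; rewrite mulrCA.
Qed.

Lemma ideal_exp_ideal {R : comNzRingType} (I : set R) k :
  is_ideal (ideal_exp I k).
Proof. by elim: k => [//|k IHk]; apply: sums_of_products_ideal. Qed.

(** Denominators are cleared: a product of finitely many elements outside a prime is again outside
    it. *)
Lemma localized_idealP {R : idomainType} (p J : set R) (f : R) :
  prime_ideal p -> is_ideal J ->
  localized_ideal p J (tofrac f) <-> exists2 s, ~ p s & J (s * f).
Proof.
move=> [[p0 p1 _] p_prime] idJ; have {}p1 : ~ p 1.
  by apply: contraNnot p1 => /mem_set.
have {}p0 : p 0 := set_mem p0.
have pM s t : ~ p s -> ~ p t -> ~ p (s * t).
  move=> ps pt pst; have /orP[] := p_prime s t (mem_set pst).
    by move/set_mem.
  by move/set_mem.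
have pN0 s : ~ p s -> tofrac s != 0.
  by move=> ps; rewrite tofrac_eq0; apply/eqP => s0; rewrite s0 in ps.
split=> [[l [Hl def_f]] | [s ps Jsf]]; last first.
  exists [:: (tofrac (s * f), tofrac 1 / tofrac s)]; rewrite big_seq1 /=; split.
    by move=> u; rewrite inE => /eqP->; split; [exists (s * f) | exists 1, s].
  by rewrite rmorphM rmorph1 mul1r mulrAC divff ?mul1r ?pN0.
(* The claim is stated in the fraction field to allow induction on the sum, whose partial sums need
   not come from [R]. *)
suff [s ps [j Jj def_j]] : exists2 s, ~ p s &
    exists2 j, J j & tofrac s * tofrac f = tofrac j.
  exists s => //; move: def_j; rewrite -rmorphM => /eqP.
  by rewrite tofrac_eq => /eqP->.
rewrite {}def_f; elim: l Hl => [|u l IHl] Hl.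
  by exists 1 => //; exists 0; rewrite ?big_nil ?mulr0 ?rmorph0 //; case: idJ.
have [s ps [j Jj def_j]] : exists2 s, ~ p s &
    exists2 j, J j & tofrac s * (\sum_(u <- l) u.1 * u.2) = tofrac j.
  by apply: IHl => v lv; apply: Hl; rewrite inE lv orbT.
have [[a Ja def_a] [b [t [pt def_b]]]] := Hl u (mem_head _ _).
exists (s * t); first exact: pM.
(* The new term is a (b / t) and the earlier ones sum to j / s; this is the numerator over s t. *)
exists ((s * b) * a + t * j).
  by case: (idJ) => _; apply=> //; apply: is_idealM.
rewrite big_cons -def_a def_b rmorphD !rmorphM /= -def_j.
by field; apply: pN0.
Qed.

End Ideals.

(** * Monomial ideals and the prime of the origin *)

Section MonomialIdeals.
Set Implicit Arguments.
Unset Strict Implicit.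
Local Open Scope ring_scope.
Import GRing.Theory.
Context {K : fieldType} {n : nat}.
Implicit Types (A B J : set {mpoly K[n]}) (f g : {mpoly K[n]}).

(** For an ideal this means being a monomial ideal; it is stated for any set so as to apply to
    generating sets too. *)
Definition monomial_closed A : Prop :=
  forall f m, A f -> m \in msupp f -> A 'X_[m].

(** Cancellation can only shrink supports, so [m] already occurs in one of the products, as a sum of
    exponents from its two factors. *)
Lemma msupp_sums_of_products A B f m :
  monomial_closed A -> monomial_closed B ->
  sums_of_products A B f -> m \in msupp f ->
  exists a b, [/\ A 'X_[a], B 'X_[b] & m = (a + b)%MM].
Proof.
move=> monA monB [l [+ ->]] {f}; elim: l => [_|u l IHl Hl].
  by rewrite big_nil msupp0.
rewrite big_cons => /msuppD_le; rewrite mem_cat => /orP[|]; last first.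
  by apply: IHl => v lv; apply: Hl; rewrite inE lv orbT.
have [Au Bu] := Hl u (mem_head _ _).
case/msuppM_le/allpairsP=> -[a b] /= [a_u b_u ->].
by exists a, b; split=> //; [apply: monA Au a_u | apply: monB Bu b_u].
Qed.

Lemma monomial_closed_sums_of_products A B :
  monomial_closed A -> monomial_closed B ->
  monomial_closed (sums_of_products A B).
Proof.
move=> monA monB f m ABf /(msupp_sums_of_products monA monB ABf).
by move=> [a [b [Aa Bb ->]]]; rewrite mpolyXD; apply: sums_of_products_mul.
Qed.

Lemma monomial_closed_ideal_exp I k :
  monomial_closed I -> monomial_closed (ideal_exp I k).
Proof.
by move=> monI; elim: k => // k IHk; apply: monomial_closed_sums_of_products.
Qed.

(* Induction on the degree of the monomial m: if no smaller monomial of f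
   outside J exists, the coefficient of g f at m is g(0) f_m. *)
Lemma monomial_ideal_cancel J f g :
  is_ideal J -> monomial_closed J -> g@_0%MM != 0 -> J (g * f) -> J f.
Proof.
move=> idJ monJ g0 Jgf; suff Jm m : m \in msupp f -> J 'X_[m].
  rewrite (mpolyE f); apply: is_ideal_sum => // m /Jm Jm'.
  by rewrite -mul_mpolyC; apply: is_idealM.
have [d] := ubnP (mdeg m); elim: d m => // d IHd m; rewrite ltnS => le_md fm.
apply: contrapT => NJm; apply: (NJm); apply: monJ Jgf _.
rewrite mcoeff_msupp (mcoeff_poly_mul_lin _ _ (ltnSn _)).
rewrite (bigD1 bm0) /=; last by apply/mnm_lepP => i; rewrite mnm0E.
rewrite subm0 big1 ?addr0.
  by rewrite mulf_neq0 // -mcoeff_msupp.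
(* Since [i] is nonzero, [m - i] has smaller degree; were it in the support of [f], its monomial
   would lie in [J], and so would its multiple ['X_[m]]. *)
move=> i /andP[le_im ne_i0]; case: (boolP ((m - i)%MM \in msupp f)) => [fmi|].
  case: NJm; rewrite -(submK le_im) addmC mpolyXD.
  apply: is_idealM => //; apply: IHd fmi; apply: leq_trans le_md.
  have deg_m := congr1 mdeg (submK le_im); rewrite mdegD in deg_m.
  rewrite -[ltnRHS]deg_m -addn1 leq_add2l lt0n mdeg_eq0.
  by apply: contraNneq ne_i0 => i0; apply/eqP/val_inj.
by rewrite mcoeff_msupp negbK => /eqP->; rewrite mulr0.
Qed.

(** This is the kernel of the constant coefficient, a ring morphism to a field. *)
Lemma origin_prime_ideal : prime_ideal [set g : {mpoly K[n]} | g@_0%MM = 0].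
Proof.
split; [split|].
- by apply/mem_set; rewrite /= mcoeff0.
- apply/negP => /set_mem /= /eqP; apply/negP.
  by rewrite mcoeff1 eqxx oner_neq0.
- move=> a u v /set_mem /= u0 /set_mem /= v0; apply/mem_set.
  by rewrite /= mcoeffD rmorphM /= u0 v0 mulr0 addr0.
move=> u v /set_mem /= /eqP; rewrite rmorphM mulf_eq0.
by case/orP=> /eqP uv0; apply/orP; [left|right]; apply/mem_set.
Qed.

End MonomialIdeals.

(** * Edge ideals and their associated prime at the origin *)

Section EdgeIdeals.
Set Implicit Arguments.
Unset Strict Implicit.
Local Open Scope ring_scope.
Import GRing.Theory.
Context {K : fieldType} {n : nat} (D : wodigraph n).

Definition edge_mnm (x y : 'I_n) : 'X_{1..n} :=
  (U_(x) + U_(y) *+ weight D y)%MM.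

Definition edge_monomials : set {mpoly K[n]} :=
  [set m | exists x y : 'I_n,
    (x, y) \in arcs D /\ m = 'X_x * 'X_y ^+ weight D y]%classic.

Lemma edge_mnmE (x y : 'I_n) :
  'X_x * 'X_y ^+ weight D y = 'X_[edge_mnm x y] :> {mpoly K[n]}.
Proof. by rewrite mpolyXn -mpolyXD. Qed.

Lemma monomial_closed_edge_monomials : monomial_closed edge_monomials.
Proof.
move=> _ m [x [y [arc_xy ->]]]; rewrite edge_mnmE msuppX inE => /eqP->.
by exists x, y; rewrite edge_mnmE.
Qed.

Lemma monomial_closed_edge_ideal : monomial_closed (edge_ideal K D).
Proof.
exact: monomial_closed_sums_of_products monomial_closed_edge_monomials _.
Qed.

Lemma edge_ideal_is_ideal : is_ideal (edge_ideal K D).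
Proof. exact: sums_of_products_ideal. Qed.

Lemma edge_ideal_mpolyX (m : 'X_{1..n}) :
  edge_ideal K D 'X_[m] <->
  exists x y, (x, y) \in arcs D /\ (edge_mnm x y <= m)%MM.
Proof.
split=> [Im | [x [y [arc_xy le_xy_m]]]]; last first.
  rewrite -(submK le_xy_m) addmC mpolyXD; apply: sums_of_products_mul => //.
  by exists x, y; rewrite edge_mnmE.
have m_m : m \in msupp ('X_[m] : {mpoly K[n]}) by rewrite msuppX mem_head.
have setT_mon : monomial_closed (setT : set {mpoly K[n]}) by [].
have [a [b [[x [y [arc_xy def_a]]] _ ->]]] :=
  msupp_sums_of_products monomial_closed_edge_monomials setT_mon Im m_m.
exists x, y; split=> //; suff -> : edge_mnm x y = a by exact: lem_addr.
have: a \in msupp ('X_[a] : {mpoly K[n]}) by rewrite msuppX mem_head.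
by rewrite def_a edge_mnmE msuppX inE => /eqP.
Qed.

Lemma origin_Ass_edge_ideal :
  (forall x, exists2 y, (y, x) \in arcs D & (1 < weight D y)%N) ->
  Ass (edge_ideal K D) [set g : {mpoly K[n]} | g@_0%MM = 0]%classic.
Proof.
move=> pred; split; first exact: origin_prime_ideal.
pose F := [multinom (weight D i).-1 | i < n].
exists 'X_[F]; apply/seteqP; split=> g /=; last first.
  move=> IgF; apply: contrapT => /eqP g0.
  have := monomial_ideal_cancel edge_ideal_is_ideal monomial_closed_edge_ideal
    g0 IgF.
  (* At [y] the edge monomial has exponent at least w(y), but [F] only w(y) - 1. *)
  move=> /edge_ideal_mpolyX[x [y [_ /mnm_lepP/(_ y)]]].
  rewrite mnmDE mulmnE mnmE !mnm1E eqxx mul1n mnmE.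
  by rewrite leqNgt -{2}(prednK (weight_gt0 D y)) addnS ltnS leq_addl.
move=> g0; rewrite (mpolyE g) mulr_suml.
apply: is_ideal_sum => [|m g_m]; first exact: edge_ideal_is_ideal.
rewrite -mul_mpolyC -mulrA -mpolyXD; apply: is_idealM.
  exact: edge_ideal_is_ideal.
(* As g(0) = 0, the zero exponent is not in the support of [g]. *)
have [x mx] : exists x, m x != 0%N.
  apply: contrapT => m0; move: g_m; rewrite mcoeff_msupp; apply/negP.
  rewrite negbK; suff -> : m = 0%MM by apply/eqP.
  apply/mnmP=> x; rewrite mnm0E; apply/eqP; apply: contrapT => mx.
  by apply: m0; exists x; apply/negP.
have [y arc_yx wy] := pred x.
(* The generator of the arc y -> x divides: the exponent of x is at least 1 + (w(x) - 1), and that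
   of y at least w(y) - 1, which is positive by [wy]. *)
apply/edge_ideal_mpolyX; exists y, x; split=> //.
have neq_yx : y != x.
  by apply: contraTneq arc_yx => ->; apply: arcs_irrefl.
apply/mnm_lepP=> i; rewrite !mnmDE mulmnE !mnm1E !mnmE.
have [<-|neq_yi] := eqVneq y i.
  rewrite eq_sym (negPf neq_yx) mul0n addn0; apply: leq_trans (leq_addl _ _).
  by rewrite -ltnS prednK ?weight_gt0.
have [<-|//] := eqVneq x i.
rewrite mul1n add0n -{1}(prednK (weight_gt0 D x)) -add1n leq_add2r.
by rewrite lt0n.
Qed.

End EdgeIdeals.

Theorem corollary3p2 (K : fieldType) (n : nat) (D : wodigraph n)
    (s : nat) (Ds : 'I_s -> subdigraph D)
    (Ds_unicyclic : forall i : 'I_s, naturally_oriented_unicyclic (Ds i))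
    (Ds_disjoint : forall i j : 'I_s, i != j ->
       [disjoint sverts (Ds i) & sverts (Ds j)])
    (Ds_cover : forall x : 'I_n, exists i : 'I_s, x \in sverts (Ds i))
    (Ds_weight : forall (i : 'I_s) (x : 'I_n), x \in sverts (Ds i) ->
       1 < sdeg (Ds i) x -> weight D x <> 1) :
  forall k : nat, 1 <= k ->
    symbolic_power (edge_ideal K D) k = ideal_exp (edge_ideal K D) k.
Proof.
move=> k _; have pred x : exists2 y, (y, x) \in arcs D & 1 < weight D y.
  have [i xi] := Ds_cover x.
  have [y [arc_yx yi deg_y]] := natural_orientation_pred_deg (Ds_unicyclic i) xi.
  exists y; first exact: (fintype.subsetP (sarcs_sub (Ds i))).
  have /eqP := Ds_weight i y yi deg_y.
  by rewrite ltn_neqAle eq_sym => ->; apply: weight_gt0.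
apply/seteqP; split=> f => [Ikf | Ikf p [prime_p _]].
  (* Among the components of the symbolic power, the one at the origin forces [f] into the ordinary
     power. *)
  have m_prime := @origin_prime_ideal K n.
  have idIk := ideal_exp_ideal (edge_ideal K D) k.
  have /(localized_idealP f m_prime idIk)[g /eqP g0 gf] :=
    Ikf _ (origin_Ass_edge_ideal pred).
  apply: monomial_ideal_cancel idIk _ g0 gf.
  exact/monomial_closed_ideal_exp/monomial_closed_edge_ideal.
apply/(localized_idealP f prime_p (ideal_exp_ideal _ _)).
(* An element of the ordinary power lies in every localization, with denominator 1. *)
exists 1%R; last by rewrite GRing.mul1r.
by case: prime_p => -[_ p1 _] _; apply: contraNnot p1 => /mem_set.
Qed.
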